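(* For any constant $\varepsilon>0$, the deterministic algorithm DirectExchange solves the NeighborExchange problem in the $\mathcal{GOSSIP}$ model using $O\!\left(\frac{\delta\log n}{\varepsilon^2}\right)$ rounds, where $n$ is the number of nodes and $\delta$ is the hereditary density of the underlying topology. During the algorithm, each node initiates at most $2(1+\varepsilon)^2\delta$ exchanges.
   Context: $\mathcal{GOSSIP}$ model: synchronous rounds on an undirected graph; in each round each node may initiate a bidirectional communication with at most one neighbor, and the endpoints of each initiated communication exchange messages of unbounded size. NeighborExchange problem: each node has an initial message and every node must obtain the initial messages of all of its neighbors. The hereditary density $\delta$ of $G$ is the minimal integer such that every induced subgraph on a node set $S$ has at most $\delta|S|$ edges ($\delta$ is not known to the nodes). Algorithm DirectExchange, run by each node $v$ with neighbor set $\Gamma(v)$: set $\delta'=1$ and $H=\emptyset$ ($H$ is the set of neighbors $v$ has exchanged messages with). Repeat: set $\delta'=(1+\varepsilon)\delta'$; then for $c\,\varepsilon^{-1}\log n$ iterations (for a suitable constant $c$): if $|\Gamma(v)\setminus H|\le\delta'$, then during the next $\delta'$ rounds exchange messages directly with all neighbors in $\Gamma(v)\setminus H$ and terminate; else wait for $\delta'$ rounds; then update $H$ (to include all neighbors that have exchanged messages with $v$, including those that initiated contact with $v$). *)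

(* Defs.v *)
From mathcomp Require Import all_boot all_order all_algebra.
From mathcomp Require Import reals exp.

Set Implicit Arguments.
Unset Strict Implicit.
Unset Printing Implicit Defensive.

Import Order.TTheory GRing.Theory Num.Theory.
Local Open Scope ring_scope.

(* A graph on V is a relation e : rel V, assumed symmetric and irreflexive
   wherever that matters. *)

Definition neighbours (V : finType) (e : rel V) (v : V) : {set V} :=
  [set u | e v u].

Definition induced_edges (V : finType) (e : rel V) (S : {set V}) :
    {set {set V}} :=
  [set [set u; v] | u in S, v in S & e u v].

Definition density_bound (V : finType) (e : rel V) (d : nat) : bool :=
  [forall S : {set V}, (#|induced_edges e S| <= d * #|S|)%N].

Lemma density_bound_ex (V : finType) (e : rel V) :
  exists d, density_bound e d.
Proof.
exists #|{: {set V}}|; apply/forallP => S.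
have [->|S_neq0] := eqVneq S set0.
  rewrite /induced_edges cards0 muln0 leqn0 cards_eq0.
  apply/eqP/setP => E; rewrite [RHS]in_set0; apply/negP.
  by case/imset2P => u v; rewrite in_set0.
apply: leq_trans (max_card _) _.
by rewrite -[X in (X <= _)%N]muln1 leq_mul2l card_gt0 S_neq0 orbT.
Qed.

Definition hereditary_density (V : finType) (e : rel V) : nat :=
  ex_minn (density_bound_ex e).

(* A deterministic algorithm in the GOSSIP model, for nodes V whose initial
   messages have type M.  [init] receives what a node knows at the start: its
   name, its set of neighbours and its initial message.  The type [payload] is
   arbitrary because messages are of unbounded size.  [step] receives, for each
   node u, the payload of u if u was a partner in this round. *)
Record gossip_algorithm (V : finType) (M : Type) := GossipAlgorithm {
  state : Type;
  payload : Type;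
  init : V -> {set V} -> M -> state;
  target : state -> option V;
  send : state -> payload;
  step : state -> (V -> option payload) -> state;
  halted : state -> bool;
  output : state -> V -> option M
}.

Section Execution.
Variables (V : finType) (M : Type) (e : rel V) (A : gossip_algorithm V M).
Implicit Type X : V -> state A.

Definition communicate X (u v : V) : bool :=
  e u v && ((target (X u) == Some v) || (target (X v) == Some u)).

Definition next_round X : V -> state A := fun v =>
  step (X v) (fun u => if communicate X v u then Some (send (X u)) else None).

(* The configuration after t rounds. *)
Definition run (m : V -> M) (t : nat) : V -> state A :=
  iter t next_round (fun v => init A v (neighbours e v) (m v)).

Definition neighbor_exchange_solved (m : V -> M) (t : nat) : Prop :=
  forall u v, e v u -> output (run m t v) u = Some (m u).

Definition all_halted (m : V -> M) (t : nat) : Prop :=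
  forall v, halted (run m t v).

Definition initiated (m : V -> M) (t : nat) (v : V) : nat :=
  \sum_(i < t) (target (run m i v) != None).

End Execution.

Definition natceil (R : realType) (x : R) : nat := `|Num.ceil x|%N.

(* A contact order says in which order v contacts the nodes of a set P when it
   exchanges messages with all of them, one per round. *)
Definition contact_order (V : finType) (ord : V -> {set V} -> seq V) : Prop :=
  forall v (P : {set V}), perm_eq (ord v P) (enum P).

Section DirectExchange.
Variables (R : realType) (V : finType) (M : Type).

Inductive dx_mode := Waiting | Exchanging of seq V | Terminated.

(* [dx_heard u] is the initial message of u once v has exchanged messages with
   u; [dx_H] is the set H of the algorithm, which catches up with [dx_heard]
   only at the end of an iteration.  [dx_iter] counts the completed iterations
   of the inner loop, [dx_clock] the rounds left in the current iteration;
   [Exchanging s] means that s is still to be contacted. *)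
Record dx_state := DxState {
  dx_self : V;
  dx_nbrs : {set V};
  dx_msg : M;
  dx_heard : V -> option M;
  dx_H : {set V};
  dx_delta : R;
  dx_iter : nat;
  dx_clock : nat;
  dx_mode_of : dx_mode
}.

Variables (eps c : R) (ord : V -> {set V} -> seq V).

Definition dx_iterations : nat := natceil (c * eps^-1 * ln #|V|%:R).

(* An iteration lasts [natceil delta'] rounds in both branches. *)
Definition dx_begin_iteration (v : V) (nbrs : {set V}) (x : M)
    (heard : V -> option M) (H : {set V}) (delta : R) (i : nat) : dx_state :=
  DxState v nbrs x heard H delta i (natceil delta)
    (if #|nbrs :\: H|%:R <= delta then Exchanging (ord v (nbrs :\: H))
     else Waiting).

Definition dx_init (v : V) (nbrs : {set V}) (x : M) : dx_state :=
  dx_begin_iteration v nbrs x (fun=> None) set0 (1 + eps) 0.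

Definition dx_target (s : dx_state) : option V :=
  if dx_mode_of s is Exchanging (u :: _) then Some u else None.

Definition dx_halted (s : dx_state) : bool :=
  if dx_mode_of s is Terminated then true else false.

(* The loop test comes at the end of an iteration, so at least one iteration is
   made for each value of delta'.  This matters only when #|V| = 1, where
   [dx_iterations] is 0. *)
Definition dx_step (s : dx_state) (recv : V -> option M) : dx_state :=
  let: DxState v nbrs x heard H delta i k mode := s in
  let heard' u := if recv u is Some y then Some y else heard u in
  if mode is Terminated then DxState v nbrs x heard' H delta i k mode
  else if (1 < k)%N then
    DxState v nbrs x heard' H delta i k.-1
      (if mode is Exchanging todo then Exchanging (behead todo) else mode)
  else
    let H' := [set u in nbrs | isSome (heard' u)] in
    if mode is Exchanging _ then DxState v nbrs x heard' H' delta i 0 Terminated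
    else if (i.+1 < dx_iterations)%N then
      dx_begin_iteration v nbrs x heard' H' delta i.+1
    else dx_begin_iteration v nbrs x heard' H' ((1 + eps) * delta) 0.

Definition direct_exchange : gossip_algorithm V M :=
  GossipAlgorithm dx_init dx_target dx_msg dx_step dx_halted dx_heard.

End DirectExchange.

(* Main.v *)
(** A node terminates only after contacting all neighbours that it has not yet
    met, and nothing is exchanged otherwise; hence, as long as a node is active,
    the neighbours it has not met are exactly its active neighbours, and the
    nodes stay synchronised.  The active nodes induce a subgraph with at most
    delta edges per node, so once delta' >= 2 (1 + eps) delta at most a fraction
    1 / (1 + eps) of them has more than delta' active neighbours and survives
    the iteration.  The first such value of delta' is below
    2 (1 + eps)^2 delta, and O(log n / eps) iterations with it leave no active
    node.  A node initiates at most delta' exchanges, all in one iteration, and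
    the rounds over all values of delta' add up as a geometric series. *)

Require Import Defs.
From mathcomp Require Import all_boot all_order all_algebra.
From mathcomp Require Import reals exp.
From mathcomp Require Import ring lra.

Set Implicit Arguments.
Unset Strict Implicit.
Unset Printing Implicit Defensive.

Import Order.TTheory GRing.Theory Num.Theory.
Local Open Scope ring_scope.

(** * Rounding up, and a lower bound for the logarithm *)

Lemma natceilE (R : realType) (x : R) :
  0 <= x -> (natceil x)%:R = (Num.ceil x)%:~R :> R.
Proof.
move=> x_ge0; rewrite /natceil pmulrn gez0_abs // ceil_ge0.
by apply: lt_le_trans x_ge0; rewrite ltrN10.
Qed.

Lemma natceil_ge (R : realType) (x : R) : 0 <= x -> x <= (natceil x)%:R.
Proof. by move=> x_ge0; rewrite natceilE ?ceil_ge. Qed.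

Lemma natceil_lt (R : realType) (x : R) : 0 <= x -> (natceil x)%:R < x + 1.
Proof.
by move=> x_ge0; rewrite natceilE // -ltrBlDr -[1]/(1%:~R) -intrB ceilB1_lt.
Qed.

Lemma natceil_gt0 (R : realType) (x : R) : 0 < x -> (0 < natceil x)%N.
Proof.
move=> x_gt0; rewrite -(ltr_nat R).
exact: lt_le_trans x_gt0 (natceil_ge (ltW x_gt0)).
Qed.

(** This is [1 + y <= expR y] at [y = - ln (1 + x)]. *)
Lemma ln1D_ge (R : realType) (x : R) : 0 <= x -> x / (1 + x) <= ln (1 + x).
Proof.
move=> x_ge0; have x1_gt0 : 0 < 1 + x by rewrite ltr_wpDr.
have := expR_ge1Dx (- ln (1 + x)); rewrite expRN lnK ?posrE // => h.
have -> : x / (1 + x) = 1 - (1 + x)^-1 by field; rewrite gt_eqF.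
by lra.
Qed.

(** * Degrees and hereditary density *)

(** Double counting: the ordered adjacent pairs inside [S] are grouped by their underlying edge. *)
Lemma sum_degrees_le (V : finType) (e : rel V) (S : {set V}) :
  (\sum_(v in S) #|neighbours e v :&: S| <= 2 * #|induced_edges e S|)%N.
Proof.
pose P (x : V * V) := [&& x.1 \in S, x.2 \in S & e x.1 x.2].
pose f (x : V * V) := [set x.1; x.2].
have -> : (\sum_(v in S) #|neighbours e v :&: S| = \sum_(x | P x) 1)%N.
  rewrite -(pair_big_dep _ (fun v u => (u \in S) && e v u) (fun _ _ => 1%N)) /=.
  apply: eq_bigr => v _; rewrite sum1_card; apply: eq_card => u.
  by rewrite !inE andbC.
rewrite (partition_big f (mem (induced_edges e S))) /=; last first.
  case=> u v /and3P[/= uS vS euv]; apply/imset2P.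
  by exists u v; rewrite ?inE ?vS.
rewrite mulnC -sum_nat_const; apply: leq_sum => E /imset2P[u v _ _ ->].
(* The fibre over an edge contains at most its two orientations. *)
rewrite sum1_card; apply: leq_trans (_ : #|[set (u, v); (v, u)]| <= 2)%N.
  apply/subset_leq_card/subsetP => -[a b]; rewrite !inE.
  move=> /andP[_ /eqP/setP E'].
  have := E' a; have := E' b; have := E' u; have := E' v.
  rewrite !inE !xpair_eqE !eqxx !orbT /= (eq_sym u a) (eq_sym u b).
  rewrite (eq_sym v a) (eq_sym v b).
  by do 4![case: eqP => //= _].
by rewrite cards2; case: eqP.
Qed.

Lemma hereditary_densityP (V : finType) (e : rel V) (S : {set V}) :
  (#|induced_edges e S| <= hereditary_density e * #|S|)%N.
Proof. by rewrite /hereditary_density; case: ex_minnP => d /forallP/(_ S). Qed.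

Lemma hereditary_density_gt0 (V : finType) (e : rel V) (u v : V) :
  e u v -> (0 < hereditary_density e)%N.
Proof.
move=> euv; have := hereditary_densityP e setT.
rewrite lt0n; apply: contraTneq => ->; rewrite mul0n leqn0 cards_eq0.
apply/set0Pn; exists [set u; v]; apply/imset2P; exists u v => //.
by rewrite !inE.
Qed.

Lemma mem_takeS (T : eqType) (r : nat) (x : T) (s : seq T) :
  (x \in take r.+1 s) = (x \in take r s) || (ohead (drop r s) == Some x).
Proof.
rewrite -addn1 takeD mem_cat; congr (_ || _).
by case: (drop r s) => [|y s'] //=; rewrite take0 inE eq_sym.
Qed.

(** * The schedule of iterations, independent of any execution *)

Section Schedule.
Variables (R : realType) (V : finType) (eps c : R) (e : rel V).

(* Not [dx_iterations] itself: at least one iteration is made even when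
   [dx_iterations] is 0. *)
Definition inner_iterations : nat := maxn 1 (dx_iterations V eps c).
Local Notation K := inner_iterations.

Lemma inner_iterations_gt0 : (0 < K)%N.
Proof. by rewrite leq_max. Qed.

(** Since [i.+1] is at least 1, the maximum with 1 leaves the loop test unchanged. *)
Lemma ltn_inner_iterations i : (i.+1 < dx_iterations V eps c)%N = (i.+1 < K)%N.
Proof. by rewrite /inner_iterations leq_max. Qed.

(* Iterations are numbered consecutively through all values of delta'. *)
Definition threshold (p : nat) : R := (1 + eps) ^+ (p %/ K).+1.

Definition duration (p : nat) : nat := natceil (threshold p).

Definition start (p : nat) : nat := (\sum_(q < p) duration q)%N.

(** The nodes meant to be still running when iteration [p] starts; that the execution agrees is part
    of the invariant [on_schedule]. *)
Fixpoint active (p : nat) : {set V} :=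
  if p is q.+1 then
    [set v in active q |
      ~~ (#|neighbours e v :&: active q|%:R <= threshold q)]
  else setT.

Definition remaining (p : nat) (v : V) : {set V} :=
  neighbours e v :&: active p.

Definition low (p : nat) (v : V) : bool := #|remaining p v|%:R <= threshold p.

Lemma mem_activeS p v : (v \in active p.+1) = (v \in active p) && ~~ low p v.
Proof. by rewrite inE. Qed.

Lemma subset_active p q : (p <= q)%N -> active q \subset active p.
Proof.
elim: q => [|q IH]; first by rewrite leqn0 => /eqP ->.
rewrite leq_eqVlt => /predU1P[-> //|/IH]; apply: subset_trans.
by apply/subsetP => v; rewrite mem_activeS => /andP[].
Qed.

Lemma modn_inner_iterationsS p :
  (p.+1 %% K)%N = if ((p %% K).+1 < K)%N then (p %% K).+1 else 0%N.
Proof.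
have K_gt0 := inner_iterations_gt0; rewrite {1}(divn_eq p K) -addnS modnMDl.
have := ltn_pmod p K_gt0; rewrite leq_eqVlt.
by case/predU1P => [->|h]; [rewrite ltnn modnn|rewrite h modn_small].
Qed.

Lemma thresholdS p :
  threshold p.+1 = if ((p %% K).+1 < K)%N then threshold p
                   else (1 + eps) * threshold p.
Proof.
have K_gt0 := inner_iterations_gt0.
rewrite /threshold {1}(divn_eq p K) -addnS divnMDl //.
have := ltn_pmod p K_gt0; rewrite leq_eqVlt.
case/predU1P => [->|h]; first by rewrite ltnn divnn K_gt0 addn1 exprS.
by rewrite h (divn_small h) addn0.
Qed.

Lemma startS p : start p.+1 = (start p + duration p)%N.
Proof. by rewrite /start big_ord_recr. Qed.

Lemma leq_start : {homo start : p q / (p <= q)%N}.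
Proof.
apply: homo_leq => [//|y x z|p]; first exact: leq_trans.
by rewrite startS leq_addr.
Qed.

Hypothesis eps_gt0 : 0 < eps.

Lemma threshold_gt0 p : 0 < threshold p.
Proof. by rewrite exprn_gt0 // addr_gt0. Qed.

Lemma duration_gt0 p : (0 < duration p)%N.
Proof. exact/natceil_gt0/threshold_gt0. Qed.

Lemma low_leq_duration p v : low p v -> (#|remaining p v| <= duration p)%N.
Proof.
rewrite /low => h; rewrite -(ler_nat R); apply: le_trans h _.
exact/natceil_ge/ltW/threshold_gt0.
Qed.

(** Degrees inside [active p] sum to at most [2 * d * #|active p|], while each survivor contributes
    more than [threshold p]. *)
Lemma active_shrinks p :
  2 * (1 + eps) * (hereditary_density e)%:R <= threshold p ->
  #|active p.+1|%:R * (1 + eps) <= #|active p|%:R :> R.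
Proof.
set d := hereditary_density e => d_le.
have [->|S_neq0] := eqVneq (active p.+1) set0.
  by rewrite cards0 mul0r.
have : #|active p.+1|%:R * threshold p <= 2 * d%:R * #|active p|%:R :> R.
  rewrite -[2 * d%:R]/(2%:R * d%:R) -!natrM.
  apply: le_trans (_ : (\sum_(v in active p) #|remaining p v|)%:R <= _);
    last first.
    rewrite ler_nat; apply: leq_trans (sum_degrees_le e (active p)) _.
    by rewrite -mulnA leq_mul2l /= hereditary_densityP.
  rewrite natr_sum mulr_natl -sumr_const.
  rewrite [leRHS](big_setID (active p.+1)) /=.
  rewrite (setIidPr (subset_active (leqnSn p))).
  apply: ler_wpDr; first by rewrite sumr_ge0.
  by apply: ler_sum => v; rewrite mem_activeS /low -ltNge => /andP[_ /ltW].
(* The factor [2 * d] can be cancelled only if [d > 0]; for [d = 0] a survivor would make the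
   left-hand product positive. *)
have [d0|d_gt0] := posnP d.
  rewrite d0 mulr0 mul0r => h; exfalso.
  have : 0 < #|active p.+1|%:R * threshold p.
    by rewrite mulr_gt0 ?threshold_gt0 // ltr0n card_gt0.
  by rewrite ltNge h.
have d_gt0' : 0 < 2 * d%:R :> R by rewrite mulr_gt0 // ltr0n.
move=> h; rewrite -(ler_pM2l d_gt0').
apply: le_trans h; rewrite mulrCA.
by apply: ler_wpM2l => //; rewrite mulrAC.
Qed.

(** The bound on [p %% K + k] keeps the [k] iterations within one value of delta', so they share
    [threshold p]. *)
Lemma active_shrinks_iter p k :
  2 * (1 + eps) * (hereditary_density e)%:R <= threshold p ->
  (p %% K + k <= K)%N ->
  #|active (p + k)|%:R * (1 + eps) ^+ k <= #|active p|%:R :> R.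
Proof.
move=> d_le; elim: k => [|k IH] pk; first by rewrite addn0 mulr1.
rewrite addnS in pk; rewrite addnS; apply: le_trans (IH (ltnW pk)).
rewrite exprS mulrA; apply: ler_wpM2r.
  by rewrite exprn_ge0 ?addr_ge0 ?ltW.
apply: active_shrinks; rewrite /threshold {1}(divn_eq p K) -addnA divnMDl.
  by rewrite (@divn_small (_ + _)) // addn0.
exact: inner_iterations_gt0.
Qed.

(** The [K] iterations from [j * K] on have threshold [(1 + eps) ^+ j.+1] and each divides the
    active set by at least [1 + eps], which leaves less than one node. *)
Lemma active_eq0 j : 2 * (hereditary_density e)%:R <= (1 + eps) ^+ j ->
  #|V|%:R < (1 + eps) ^+ K -> active (j.+1 * K) = set0.
Proof.
move=> d_le n_lt; have e1_gt0 : 0 < 1 + eps by rewrite addr_gt0.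
have K_gt0 := inner_iterations_gt0.
have := @active_shrinks_iter (j * K) K.
rewrite modnMl add0n leqnn /threshold mulnK // exprS mulrAC [in leLHS]mulrC.
rewrite ler_pM2l // -mulSnr => /(_ d_le isT) act_le.
apply/eqP; rewrite -cards_eq0 -leqn0 -ltnS -(ltr_nat R).
rewrite -(ltr_pM2r (exprn_gt0 K e1_gt0)).
rewrite mul1r; apply: le_lt_trans act_le (le_lt_trans _ n_lt).
by rewrite ler_nat max_card.
Qed.

(** A geometric series: as [x = (1 + eps) ^+ j.+1] is at least 1, its ceiling is at most [2 * x],
    and [2 * K * x] is exactly the increment of the bound. *)
Lemma start_le j : (start (j * K))%:R <= 2 * K%:R * (1 + eps) ^+ j.+1 / eps.
Proof.
have e1_ge0 : 0 <= 1 + eps by rewrite addr_ge0 ?ltW.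
elim: j => [|j IH].
  rewrite /start big_ord0; apply: mulr_ge0; last by rewrite invr_ge0 ltW.
  by rewrite !mulr_ge0 ?exprn_ge0.
have step i : (i <= K)%N ->
    start (j * K + i) = (start (j * K) + i * natceil ((1 + eps) ^+ j.+1))%N.
  elim: i => [|i IHi] iK; first by rewrite !addn0.
  rewrite addnS startS IHi 1?ltnW // mulSnr addnA.
  congr (_ + natceil (_ ^+ _.+1))%N.
  by rewrite divnMDl ?inner_iterations_gt0 // divn_small // addn0.
rewrite mulSnr step // natrD natrM.
have p1 : 1 <= (1 + eps) ^+ j.+1 by rewrite exprn_ege1 // lerDl ltW.
have := natceil_lt (le_trans ler01 p1).
set x := (1 + eps) ^+ j.+1 in IH p1 *; move=> /ltW y_le.
apply: le_trans (lerD IH (ler_wpM2l _ y_le)) _ => //.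
rewrite exprSr -/x; set k : R := K%:R; have k_ge0 : 0 <= k by rewrite ler0n.
have -> : 2 * k * (x * (1 + eps)) / eps = 2 * k * x / eps + k * (x + x).
  by field; rewrite gt_eqF.
by rewrite lerD2l; apply: ler_wpM2l => //; rewrite lerD2l.
Qed.

End Schedule.

(** * The execution follows the schedule *)

Section Execution.
Variables (R : realType) (V : finType) (M : Type) (eps c : R) (e : rel V).
Variables (ord : V -> {set V} -> seq V) (m : V -> M).
Hypotheses (eps_gt0 : 0 < eps) (e_sym : symmetric e).
Hypothesis ordP : contact_order ord.

Local Notation A := (direct_exchange M eps c ord).
Local Notation K := (inner_iterations V eps c).
Local Notation threshold := (threshold V eps c).
Local Notation duration := (duration V eps c).
Local Notation start := (start V eps c).
Local Notation active := (active eps c e).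
Local Notation remaining := (remaining eps c e).
Local Notation low := (low eps c e).
Implicit Type X : V -> state A.

Definition todo (p : nat) (v : V) : seq V := ord v (remaining p v).

Lemma mem_todo p v u : (u \in todo p v) = e v u && (u \in active p).
Proof. by rewrite (perm_mem (ordP _ _)) mem_enum !inE. Qed.

Lemma size_todo p v : size (todo p v) = #|remaining p v|.
Proof. by rewrite (perm_size (ordP _ _)) cardE. Qed.

Definition mode (p r : nat) (v : V) : dx_mode V :=
  if v \in active p then
    if low p v then Exchanging (drop r (todo p v)) else Waiting V
  else Terminated V.

(* After [r] rounds of iteration [p], [v] has exchanged messages with its
   neighbour [u]. *)
Definition met (p r : nat) (v u : V) : bool :=
  [|| v \notin active p, u \notin active p,
      low p v && (u \in take r (todo p v)) |
      low p u && (v \in take r (todo p u))].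

(** The invariant after [r] rounds of iteration [p]. The full record is fixed only for active nodes,
    since the counters of a terminated node freeze at values depending on when it stopped. [heard]
    is existential because [dx_heard] is determined on neighbours only. *)
Definition on_schedule (p r : nat) (X : V -> state A) : Prop :=
  forall v, [/\ dx_msg (X v) = m v, dx_mode_of (X v) = mode p r v,
    forall u, e v u ->
      dx_heard (X v) u = (if met p r v u then Some (m u) else None)
    & v \in active p -> exists heard,
      X v = DxState v (neighbours e v) (m v) heard
              (neighbours e v :\: active p) (threshold p) (p %% K)
              (duration p - r) (mode p r v)].

Lemma met0 p v u :
  met p 0 v u = (v \notin active p) || (u \notin active p).
Proof. by rewrite /met !take0 !in_nil !andbF !orbF. Qed.

(** A low node exhausts its list within [duration p] rounds, so the pairs met during the iteration
    are those with a low endpoint, which then becomes inactive. *)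
Lemma met_duration p v u : e v u -> met p (duration p) v u = met p.+1 0 v u.
Proof.
move=> evu; rewrite met0 !mem_activeS /met.
have [vS|] //= := boolP (v \in active p);
  have [uS|] //= := boolP (u \in active p).
  rewrite !negbK; congr (_ || _).
    have [lv|//] /= := boolP (low p v).
    rewrite take_oversize ?size_todo ?low_leq_duration //.
    by rewrite mem_todo evu.
  have [lu|//] /= := boolP (low p u).
  rewrite take_oversize ?size_todo ?low_leq_duration //.
  by rewrite mem_todo e_sym evu.
by rewrite orbT.
Qed.

Lemma dx_target_mode p r X v : on_schedule p r X ->
  dx_target (X v) =
  if (v \in active p) && low p v then ohead (drop r (todo p v)) else None.
Proof.
move=> /(_ v)[_ h _ _]; rewrite /dx_target h /mode.
by case: ifP => //= _; case: ifP => // _; case: drop.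
Qed.

(** The current contact of a low node is the head of [drop r], the element by which its prefix
    [take r] grows. *)
Lemma metS p r X v u : on_schedule p r X -> e v u ->
  met p r.+1 v u = communicate e X v u || met p r v u.
Proof.
move=> hX evu; rewrite /communicate evu /= !(dx_target_mode _ hX) /met.
case: (v \in active p); rewrite ?orbT //=.
case: (u \in active p); rewrite ?orbT //=.
rewrite !mem_takeS.
case: (low p v); case: (low p u); case: (u \in take r _);
  by case: (v \in take r _); case: (ohead _ == _); case: (ohead _ == _).
Qed.

Lemma dx_heard_step (s : dx_state R V M) recv u :
  dx_heard (dx_step eps c ord s recv) u =
  if recv u is Some y then Some y else dx_heard s u.
Proof.
case: s => v nb x h H d i k [|l|] //=; case: ifP => // _; case: ifP => //.
Qed.

Lemma dx_msg_step (s : dx_state R V M) recv :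
  dx_msg (dx_step eps c ord s recv) = dx_msg s.
Proof.
case: s => v nb x h H d i k [|l|] //=; case: ifP => // _; case: ifP => //.
Qed.

Lemma dx_heard_next_round p r X v u : on_schedule p r X -> e v u ->
  dx_heard (next_round e X v) u = if met p r.+1 v u then Some (m u) else None.
Proof.
move=> hX evu; rewrite /next_round [LHS]dx_heard_step (metS hX evu).
have [_ _ -> // _] := hX v; have [mu _ _ _] := hX u.
by case: communicate; rewrite //= [dx_msg _]mu.
Qed.

Lemma on_scheduleS p r X : (r.+1 < duration p)%N ->
  on_schedule p r X -> on_schedule p r.+1 (next_round e X).
Proof.
move=> r_lt hX v; have [msg_v mode_v _ st_v] := hX v.
have [vS|vS] := boolP (v \in active p); last first.
  split=> //; first by rewrite /next_round [LHS]dx_msg_step.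
    move: mode_v; rewrite /mode (negPf vS) /next_round.
    by case: (X v) => v0 nb x h H d i k md /= ->.
  by move=> u; exact: dx_heard_next_round.
have [h Xv] := st_v vS.
have nX : exists h', next_round e X v =
    DxState v (neighbours e v) (m v) h' (neighbours e v :\: active p)
      (threshold p) (p %% K) (duration p - r.+1) (mode p r.+1 v).
  eexists; rewrite {1}/next_round Xv /= /mode vS.
  rewrite ltn_subRL addn1 r_lt subnS.
  by case: ifP => //= _; rewrite -drop1 drop_drop add1n.
have [h' nXv] := nX.
split; [by rewrite nXv|by rewrite nXv| |by []].
by move=> u; exact: dx_heard_next_round.
Qed.

(** With [H] the inactive neighbours, the unmet neighbours are [remaining p v], so the test of the
    algorithm is [low p v]. *)
Lemma dx_begin_iterationE p v heard : v \in active p ->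
  dx_begin_iteration ord v (neighbours e v) (m v) heard
    (neighbours e v :\: active p) (threshold p) (p %% K) =
  DxState v (neighbours e v) (m v) heard (neighbours e v :\: active p)
    (threshold p) (p %% K) (duration p - 0) (mode p 0 v).
Proof.
move=> vS; rewrite /dx_begin_iteration /mode vS subn0 drop0.
by rewrite setDDr setDv set0U.
Qed.

Lemma on_schedule_next p r X : r.+1 = duration p ->
  on_schedule p r X -> on_schedule p.+1 0 (next_round e X).
Proof.
move=> r_eq hX v; have [msg_v mode_v _ st_v] := hX v.
have heard_v u (evu : e v u) : dx_heard (next_round e X v) u =
    if met p.+1 0 v u then Some (m u) else None.
  by rewrite -met_duration // -r_eq; exact: dx_heard_next_round.
have msg'_v : dx_msg (next_round e X v) = m v.
  by rewrite /next_round [LHS]dx_msg_step.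
have last_round : (1 < duration p - r)%N = false by rewrite -r_eq subSnn.
have [vS|vS] := boolP (v \in active p); last first.
  have vS' : v \in active p.+1 = false by rewrite mem_activeS (negPf vS).
  split=> //; last by rewrite vS'.
  move: mode_v; rewrite /mode (negPf vS) vS' /next_round.
  by case: (X v) => v0 nb x h H d i k md /= ->.
have [h Xv] := st_v vS.
have [lv|lv] := boolP (low p v).
  have vS' : v \in active p.+1 = false by rewrite mem_activeS vS lv.
  split=> //; last by rewrite vS'.
  by rewrite /mode vS' /next_round Xv /= /mode vS lv last_round.
have vS' : v \in active p.+1 by rewrite mem_activeS vS lv.
have nX : exists h', next_round e X v =
    DxState v (neighbours e v) (m v) h' (neighbours e v :\: active p.+1)
      (threshold p.+1) (p.+1 %% K) (duration p.+1 - 0) (mode p.+1 0 v).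
  pose h' := dx_heard (next_round e X v).
  exists h'; rewrite -dx_begin_iterationE //.
  (* The updated [H] is the set of inactive neighbours, because a surviving [v] has met exactly
     those. *)
  have -> : neighbours e v :\: active p.+1 =
            [set u in neighbours e v | isSome (h' u)].
    apply/setP => u; rewrite !inE andbC.
    have [evu|//] /= := boolP (e v u).
    rewrite /h' heard_v // met0 vS' /=.
    by rewrite mem_activeS negb_and negbK; case: ifP.
  rewrite /h' /next_round Xv /= /mode vS (negPf lv) last_round.
  rewrite ltn_inner_iterations modn_inner_iterationsS thresholdS.
  by case: ifP.
have [h' nXv] := nX.
split=> //; by rewrite nXv.
Qed.

Lemma on_schedule_init : on_schedule 0 0 (run e A m 0).
Proof.
move=> v; have vS : v \in active 0 by rewrite inE.
have st : run e A m 0 v = DxState v (neighbours e v) (m v) (fun=> None)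
    (neighbours e v :\: active 0) (threshold 0) (0 %% K) (duration 0 - 0)
    (mode 0 0 v).
  rewrite -dx_begin_iterationE // /run /= /dx_init setDT mod0n.
  by rewrite /threshold div0n expr1.
split; rewrite ?st //=; last by exists (fun=> None).
by move=> u evu; rewrite met0 !inE.
Qed.

Lemma run_on_schedule p r :
  (r < duration p)%N -> on_schedule p r (run e A m (start p + r)).
Proof.
elim: p r => [|p IHp].
  elim=> [|r IHr] r_lt.
    by rewrite /start big_ord0; exact: on_schedule_init.
  by rewrite addnS; apply: on_scheduleS => //; exact/IHr/ltnW.
elim=> [|r IHr] r_lt; last first.
  by rewrite addnS; apply: on_scheduleS => //; exact/IHr/ltnW.
have dp := duration_gt0 V c eps_gt0 p.
rewrite addn0 startS -(prednK dp) addnS.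
by apply: on_schedule_next; [exact: prednK|apply: IHp; rewrite prednK].
Qed.

Lemma start_decomp t : exists p r, t = (start p + r)%N /\ (r < duration p)%N.
Proof.
elim: t => [|t [p [r [-> r_lt]]]].
  by exists 0%N, 0%N; rewrite /start big_ord0 duration_gt0.
have [r_lt'|] := ltnP r.+1 (duration p); first by exists p, r.+1; rewrite addnS.
move=> le_r; exists p.+1, 0%N; rewrite duration_gt0 //; split=> //.
by rewrite startS addn0 -addnS; congr addn; apply/eqP; rewrite eqn_leq r_lt.
Qed.

(** Active sets decrease, so none is left at time [t]; then [met] holds for all pairs and every mode
    is [Terminated]. *)
Lemma solved_after P t : active P = set0 -> (start P <= t)%N ->
  neighbor_exchange_solved e A m t /\ all_halted e A m t.
Proof.
move=> P0 leP; have [p [r [def_t r_lt]]] := start_decomp t.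
have p0 : active p = set0.
  have [le_Pp|lt_pP] := leqP P p.
    by apply/eqP; rewrite -subset0 -P0; exact: subset_active.
  have := leP; rewrite leqNgt def_t.
  rewrite (leq_trans _ (leq_start V eps c lt_pP)) //.
  by rewrite startS -addnS leq_add2l.
have hX := run_on_schedule r_lt; rewrite -def_t in hX.
split=> [u v evu|v].
  by have [_ _ h _] := hX v; rewrite /= [LHS]h // /met p0 !inE.
by have [_ h _ _] := hX v; rewrite /all_halted /= /dx_halted h /mode p0 inE.
Qed.

(** * Counting initiated exchanges *)

Lemma initiatedS t v :
  initiated e A m t.+1 v =
  (initiated e A m t v + (dx_target (run e A m t v) != None))%N.
Proof. by rewrite /initiated big_ord_recr. Qed.

(** Only an exchanging node has a target; its list may run out before the iteration ends, whence the
    minimum. *)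
Lemma initiated_in_iteration p r v : (r <= duration p)%N ->
  initiated e A m (start p + r) v =
  (initiated e A m (start p) v +
   if (v \in active p) && low p v then minn r (size (todo p v)) else 0)%N.
Proof.
elim: r => [|r IHr] r_lt; first by rewrite addn0 min0n if_same addn0.
rewrite addnS initiatedS IHr 1?ltnW //.
rewrite (dx_target_mode _ (run_on_schedule r_lt)).
rewrite -addnA; congr addn; case: ifP => // _.
have [lt_r|le_r] := ltnP r (size (todo p v)).
  rewrite (drop_nth v) //= (minn_idPl lt_r).
  by rewrite addn1.
by rewrite drop_oversize // addn0 (minn_idPr _) // leqW.
Qed.

Lemma initiated_active p v :
  v \in active p -> initiated e A m (start p) v = 0%N.
Proof.
elim: p => [|p IHp]; first by rewrite /start /initiated !big_ord0.
rewrite mem_activeS => /andP[vS /negPf lv].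
by rewrite startS initiated_in_iteration // IHp // vS lv.
Qed.

(** All initiations of [v] fall in the one iteration where it is active and low: the count is 0
    before, and other iterations add nothing. *)
Lemma initiated_le (D : R) t v : 0 <= D ->
  (forall p, v \in active p -> low p v -> #|remaining p v|%:R <= D) ->
  (initiated e A m t v)%:R <= D.
Proof.
move=> D_ge0 deg_le; have [p [r [-> /ltnW r_le]]] := start_decomp t.
elim: p r r_le => [|p IHp] r r_le; rewrite initiated_in_iteration //.
  rewrite /start {1}/initiated !big_ord0 add0n.
  case: ifP => [/andP[vS lv]|//]; apply: le_trans (deg_le _ vS lv).
  by rewrite ler_nat -size_todo geq_minr.
case: ifP => [/andP[vS lv]|_].
  rewrite initiated_active // add0n; apply: le_trans (deg_le _ vS lv).
  by rewrite ler_nat -size_todo geq_minr.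
by rewrite addn0 startS; exact: IHp.
Qed.

End Execution.

(** * Numerical bounds uniform in [0 < eps <= eps0] *)

Lemma pow_unbounded (R : realType) (eps x : R) :
  0 < eps -> exists j, x <= (1 + eps) ^+ j.
Proof.
move=> eps_gt0; have bernoulli j : 1 + j%:R * eps <= (1 + eps) ^+ j.
  elim: j => [|j IH]; first by rewrite mul0r addr0.
  have e1_ge0 : 0 <= 1 + eps by rewrite addr_ge0 // ltW.
  rewrite exprS; apply: le_trans (ler_wpM2l e1_ge0 IH).
  have : 0 <= j%:R * eps * eps by rewrite !mulr_ge0 // ltW.
  by rewrite -natr1 => j_eps_ge0; lra.
have [x_le0|x_gt0] := leP x 0.
  by exists 0%N; rewrite expr0 (le_trans x_le0).
exists (natceil (x / eps)); apply: le_trans (bernoulli _).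
have := natceil_ge (ltW (divr_gt0 x_gt0 eps_gt0)).
by rewrite ler_pdivrMr // => /le_trans; apply; rewrite lerDr.
Qed.

Lemma ln_ge_half (R : realType) (n : nat) : (1 < n)%N -> 1 / 2 <= ln n%:R :> R.
Proof.
move=> n_gt1.
have := @ln1D_ge R 1 ler01; rewrite -[1 + 1]/(2%:R) => /le_trans; apply.
by rewrite ler_ln ?posrE ?ltr0n ?ler_nat // ltnW.
Qed.

(** A quantity that is at least 1 at most doubles when rounded up; this turns the factor 2 into the
    4 of [inner_iterations_le]. *)
Lemma iterations_arg_ge1 (R : realType) (V : finType) (eps0 eps : R) :
  0 < eps -> eps <= eps0 -> (1 < #|V|)%N ->
  1 <= 2 * (1 + eps0) * eps^-1 * ln #|V|%:R.
Proof.
move=> eps_gt0 eps_le V_gt1.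
have h : 2 <= 2 * (1 + eps0) * eps^-1 by rewrite ler_pdivlMr //; lra.
have L_ge := (ln_ge_half R V_gt1); nra.
Qed.

Lemma inner_iterations_le (R : realType) (V : finType) (eps0 eps : R) :
  0 < eps -> eps <= eps0 -> (1 < #|V|)%N ->
  (inner_iterations V eps (2 * (1 + eps0)))%:R <=
    4 * (1 + eps0) * eps^-1 * ln #|V|%:R.
Proof.
move=> eps_gt0 eps_le V_gt1.
have h := iterations_arg_ge1 eps_gt0 eps_le V_gt1; have h0 := le_trans ler01 h.
rewrite /inner_iterations.
have /maxn_idPr -> : (1 <= dx_iterations V eps (2 * (1 + eps0)))%N.
  exact/natceil_gt0/lt_le_trans/h.
by have := natceil_lt h0; rewrite -/(dx_iterations _ _ _) => K_lt; lra.
Qed.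

(** In logarithms: [ln (1 + eps)] is at least [eps / (1 + eps0)], so the choice of [c] makes the
    right-hand side at least [2 * L], and [L > 0] gives strictness. *)
Lemma card_lt_pow (R : realType) (V : finType) (eps0 eps : R) :
  0 < eps -> eps <= eps0 -> (1 < #|V|)%N ->
  #|V|%:R < (1 + eps) ^+ (inner_iterations V eps (2 * (1 + eps0))).
Proof.
move=> eps_gt0 eps_le V_gt1.
set c := 2 * (1 + eps0); set K := inner_iterations _ _ _.
set L : R := ln #|V|%:R.
have arg_ge1 : 1 <= c * eps^-1 * L by exact: iterations_arg_ge1.
have e1_gt0 : 0 < 1 + eps by rewrite addr_gt0.
have n_gt0 : (0 < #|V|)%N by exact: ltnW.
rewrite -ltr_ln ?posrE ?exprn_gt0 ?ltr0n // lnXn // -[ltRHS]mulr_natr -/L.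
have ln_ge : eps / (1 + eps0) <= ln (1 + eps).
  apply: le_trans (ln1D_ge (ltW eps_gt0)); rewrite ler_pM2l //.
  by rewrite lef_pV2 ?posrE ?lerD2l // (lt_le_trans e1_gt0) // lerD2l.
have K_ge : c * eps^-1 * L <= K%:R.
  apply: le_trans (natceil_ge (le_trans ler01 arg_ge1)) _.
  by rewrite ler_nat leq_maxr.
have L_gt0 : 0 < L by apply: lt_le_trans (ln_ge_half R V_gt1); rewrite divr_gt0.
have eps0_gt0 : 0 < eps0 := lt_le_trans eps_gt0 eps_le.
have lt2 : L < eps / (1 + eps0) * (c * eps^-1 * L).
  have -> : eps / (1 + eps0) * (c * eps^-1 * L) = 2 * L.
    by rewrite /c; field; rewrite !gt_eqF // addr_gt0.
  by lra.
apply: lt_le_trans lt2 _; apply: ler_pM => //.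
  by rewrite divr_ge0 ?addr_ge0 // ltW.
exact: le_trans ler01 arg_ge1.
Qed.

(** The constant 16 is 2 from [start_le], 4 from [inner_iterations_le] and 2 from the bound on the
    power; one factor [1 + eps0] comes from the iteration count and three from
    [(1 + eps) ^+ j.+2]. *)
Lemma start_le_total (R : realType) (V : finType) (eps0 eps : R) (j d : nat) :
  0 < eps -> eps <= eps0 -> (1 < #|V|)%N ->
  (1 + eps) ^+ j <= 2 * d%:R * (1 + eps) ->
  (start V eps (2 * (1 + eps0))
     (j.+1 * inner_iterations V eps (2 * (1 + eps0))))%:R <=
  16 * (1 + eps0) ^+ 4 * (d%:R * ln #|V|%:R / eps ^+ 2).
Proof.
move=> eps_gt0 eps_le V_gt1 pow_le; set L : R := ln #|V|%:R.
have eps_ge0 := ltW eps_gt0.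
have L_ge0 : 0 <= L by apply: le_trans (ln_ge_half R V_gt1); rewrite divr_ge0.
have e0_ge0 : 0 <= eps0 := le_trans eps_ge0 eps_le.
apply: le_trans (start_le V _ eps_gt0 j.+1) _.
have pow3_le : (1 + eps) ^+ j.+2 <= 2 * d%:R * (1 + eps0) ^+ 3.
  apply: le_trans (_ : 2 * d%:R * (1 + eps) ^+ 3 <= _).
    rewrite -[j.+2]addn2 exprD [in leRHS]exprS mulrA; apply: ler_wpM2r => //.
    by rewrite exprn_ge0 ?addr_ge0.
  apply: ler_wpM2l; first by rewrite mulr_ge0.
  by apply: lerXn2r; rewrite ?nnegrE ?addr_ge0 // lerD2l.
have -> : 16 * (1 + eps0) ^+ 4 * (d%:R * L / eps ^+ 2) =
    2 * (4 * (1 + eps0) * eps^-1 * L) * (2 * d%:R * (1 + eps0) ^+ 3) / eps.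
  by field; rewrite gt_eqF.
apply: ler_wpM2r; first by rewrite invr_ge0.
apply: ler_pM pow3_le; first by rewrite mulr_ge0.
  by rewrite exprn_ge0 ?addr_ge0.
by rewrite ler_wpM2l // inner_iterations_le.
Qed.

(** Halting is claimed only when there is an edge: without edges delta is 0 and the time bound
    vanishes, yet a node needs one iteration to stop. *)
Theorem theorem6 (R : realType) (eps0 : R) (eps0_gt0 : 0 < eps0) :
  exists c C : R, [/\ 0 < c, 0 < C &
    forall eps : R, 0 < eps <= eps0 ->
    forall (V : finType) (e : rel V), symmetric e -> irreflexive e ->
    forall ord : V -> {set V} -> seq V, contact_order ord ->
    forall (M : Type) (m : V -> M),
    let A := direct_exchange M eps c ord in
    let n := #|V| in
    let delta := hereditary_density e in
    (forall t : nat, C * (delta%:R * ln n%:R / eps ^+ 2) <= t%:R ->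
       neighbor_exchange_solved e A m t /\
       ((exists u v, e u v) -> all_halted e A m t)) /\
    (forall (t : nat) (v : V),
       (initiated e A m t v)%:R <= 2 * (1 + eps) ^+ 2 * delta%:R)].
Proof.
have e01_gt0 : 0 < 1 + eps0 by rewrite addr_gt0.
exists (2 * (1 + eps0)), (16 * (1 + eps0) ^+ 4).
split; [by rewrite mulr_gt0|by rewrite mulr_gt0 ?exprn_gt0|].
move=> eps /andP[eps_gt0 eps_le] V e e_sym e_irr ord ordP M m A n d.
have e1_gt0 : 0 < 1 + eps by rewrite addr_gt0.
have bound_ge0 : 0 <= 2 * (1 + eps) ^+ 2 * d%:R.
  by rewrite !mulr_ge0 ?exprn_ge0 // ltW.
have [/existsP[a /existsP[b eab]]|no_edge] := boolP [exists a, exists b, e a b];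
    last first.
  have e0 u v : e u v = false.
    apply: contraNF no_edge => euv.
    by apply/existsP; exists u; apply/existsP; exists v.
  split=> [t _|t v]; first by split=> [u v|[u [v]]]; rewrite e0.
  apply: initiated_le => // p _ _.
  rewrite (_ : remaining _ _ _ _ _ = set0) ?cards0 //.
  by apply/setP => u; rewrite !inE e0.
have d_gt0 : (0 < d)%N := hereditary_density_gt0 eab.
have V_gt1 : (1 < #|V|)%N.
  have neq_ab : a != b by apply: contraTneq eab => ->; rewrite e_irr.
  by apply: leq_trans (max_card [set a; b]); rewrite cards2 neq_ab.
(* The least such [j] overshoots [2 * d] by a factor of at most [1 + eps]. *)
pose P j := 2 * d%:R <= (1 + eps) ^+ j.
have exP : exists j, P j := pow_unbounded (2 * d%:R) eps_gt0.
case: (ex_minnP exP) => j Pj j_min.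
have pow_le : (1 + eps) ^+ j <= 2 * d%:R * (1 + eps).
  (* Minimality says nothing for [j = 0]; there the power is 1 and [d >= 1] suffices. *)
  case: j Pj j_min => [|j] _ j_min.
    have d_ge1 : 1 <= d%:R :> R by rewrite ler1n.
    by rewrite expr0; nra.
  have : ~~ P j by apply/negP => /j_min; rewrite ltnn.
  by rewrite /P -ltNge exprSr => /ltW; rewrite ler_pM2r.
set K := inner_iterations V eps (2 * (1 + eps0)).
have act0 : active eps (2 * (1 + eps0)) e (j.+1 * K) = set0.
  by apply: active_eq0 => //; exact: card_lt_pow.
split=> [t le_t|t v].
  have [] // := solved_after m eps_gt0 e_sym ordP act0 (t := t).
  by rewrite -(ler_nat R); apply: le_trans le_t; exact: start_le_total.
apply: initiated_le => // p vS; rewrite /low => /le_trans; apply.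
(* An active [v] forces [p] to precede the emptying of the active set, which caps the exponent in
   [threshold p] at [j.+1]. *)
have lt_p : (p < j.+1 * K)%N.
  rewrite ltnNge; apply: contraL vS => le_p.
  have := subset_active eps (2 * (1 + eps0)) e le_p.
  by rewrite act0 subset0 => /eqP ->; rewrite inE.
apply: le_trans (_ : (1 + eps) ^+ j.+1 <= _).
  by rewrite /threshold ler_weXn2l ?lerDl ?ltW // ltn_divLR ?inner_iterations_gt0.
rewrite exprSr expr2 mulrAC mulrA.
apply: le_trans (ler_wpM2r (ltW e1_gt0) pow_le) _.
by lra.
Qed.
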